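(* Let $p(x,y)$ be one of the following polynomials in $\mathbb{R}[x,y]$: (1) $y+xy^2+y^4$; (2) $y+a_{02}y^2+xy^3$, with $a_{02}=0$ or $a_{02}=1$; (3) $y+x^2y^2$; (4) $y+a_{02}y^2+y^3+x^2y^2$, with $a_{02}\in\mathbb{R}$ and $a_{02}^2-3<0$. Then there is no polynomial $q\in\mathbb{R}[x,y]$ such that $\det D(p,q)(x,y)>0$ for all $(x,y)\in\mathbb{R}^2$.
   Context: $\det D(p,q)=\frac{\partial p}{\partial x}\frac{\partial q}{\partial y}-\frac{\partial p}{\partial y}\frac{\partial q}{\partial x}$ is the Jacobian determinant of the map $(p,q):\mathbb{R}^2\to\mathbb{R}^2$. *)

(* Defs.v *)
From mathcomp Require Import all_boot all_order all_algebra.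
From mathcomp Require Import mpoly.

Set Implicit Arguments.
Unset Strict Implicit.
Unset Printing Implicit Defensive.

Import GRing.Theory.
Local Open Scope ring_scope.

Section Bivariate.
Variable R : comNzRingType.
Implicit Types p q : {mpoly R[2]}.

Definition varX : {mpoly R[2]} := 'X_(ord0 : 'I_2).
Definition varY : {mpoly R[2]} := 'X_(ord_max : 'I_2).

Definition partial_x p : {mpoly R[2]} := p^`M(ord0).
Definition partial_y p : {mpoly R[2]} := p^`M(ord_max).

Definition eval2 p (x y : R) : R := p.@[tnth [tuple x; y]].

Definition jacobian_det p q : {mpoly R[2]} :=
  partial_x p * partial_y q - partial_y p * partial_x q.

End Bivariate.

Arguments varX {R}.
Arguments varY {R}.

(* Main.v *)
Require Import Defs.
From mathcomp Require Import all_boot all_order all_algebra.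
From mathcomp Require Import mpoly reals.
From mathcomp Require Import boolp classical_sets topology normedtype derive realfun.
From mathcomp Require polyrcf.
From mathcomp Require Import ring lra.

Import Order.TTheory GRing.Theory Num.Theory.
Import numFieldNormedType.Exports.
Local Open Scope classical_set_scope.
Local Open Scope ring_scope.
Set Implicit Arguments.
Unset Strict Implicit.
Unset Printing Implicit Defensive.

(** Call a mate of [p] a polynomial [q] with [det D(p,q) > 0] on the plane.
    In all four families the line [y = 0] is a whole connected component of
    the level set [p = 0], with [p_x = 0] and [p_y = 1] on it.  Hence
    [det D(p,q) > 0] reads [- q_x > 0] on that line, so [x |-> q(x,0)] is a
    polynomial with negative derivative, and such a polynomial tends to
    [+oo] at [-oo] ([mate_unbounded_on_line]).

    On the other hand, the level curves of [p] close to this line fold: on one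
    side of it, they follow the line over an arbitrarily long part of the
    half-line [x < 0], and then turn back to follow a second component of
    [p = 0], asymptotic to the line.  The function [q] is monotone along each
    level curve of [p] ([mate_le_along_level]), in the direction that makes
    the values on the line at most the value at a fixed point of the second
    component once the level tends to [0].  So [q(x,0)] is bounded above for
    [x < 0], which is absurd ([no_mate_of_folded_levels]).

    The folded curves are explicit, with [y] (up to sign) as parameter.  When
    [p = g(y) + x y^k] the curve of level [c] is [x = (c - g(y)) / y^k] on
    [y > 0].  When [p = g(y) + x^2 y^2] with [g] nondecreasing it is
    [x = sqrt (c - g(y)) / y] on [y < 0]; for the fourth family, [g] is
    nondecreasing because [g' = 1 + 2 a y + 3 y^2] has discriminant
    [4 (a^2 - 3) < 0].  Taking for [c] the value of [p] at the starting point
    [(x, +-t)] and letting [t -> 0] replaces any discussion of how the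
    components of the level sets degenerate. *)

(** * Calculus of bivariate polynomials *)

(** Stated with sums and products rather than monomials, so that the chain rule
    and continuity follow from the corresponding closure properties. *)
Lemma bivar_ind (R : comNzRingType) (P : {mpoly R[2]} -> Prop) :
  (forall c, P c%:MP) -> P varX -> P varY ->
  (forall p q, P p -> P q -> P (p + q)) ->
  (forall p q, P p -> P q -> P (p * q)) -> forall p, P p.
Proof.
move=> PC PX PY PD PM; elim/mpolyind => [|c m p _ _ Pp]; first exact: PC.
apply: PD => //; rewrite -mul_mpolyC; apply: (PM) => //.
have PE (r : {mpoly R[2]}) n : P r -> P (r ^+ n).
  by move=> Pr; elim: n => [|n IH]; [exact: (PC 1) | rewrite exprS; exact: PM].
rewrite mpolyXE_id big_ord_recl big_ord1; apply: PM; apply: PE => //.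
Qed.

Section Eval.
Variable R : comNzRingType.
Implicit Types (p q : {mpoly R[2]}) (x y c : R).

Lemma eval2C c x y : eval2 c%:MP x y = c. Proof. exact: mevalC. Qed.
Lemma eval2_1 x y : eval2 1 x y = 1. Proof. exact: meval1. Qed.
Lemma eval2X x y : eval2 varX x y = x. Proof. exact: mevalXU. Qed.
Lemma eval2Y x y : eval2 varY x y = y. Proof. exact: mevalXU. Qed.
Lemma eval2D p q x y : eval2 (p + q) x y = eval2 p x y + eval2 q x y.
Proof. exact: mevalD. Qed.
Lemma eval2N p x y : eval2 (- p) x y = - eval2 p x y.
Proof. exact: mevalN. Qed.
Lemma eval2M p q x y : eval2 (p * q) x y = eval2 p x y * eval2 q x y.
Proof. exact: mevalM. Qed.
Lemma eval2Xn p n x y : eval2 (p ^+ n) x y = eval2 p x y ^+ n.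
Proof. exact: rmorphXn. Qed.
Lemma eval2Z c p x y : eval2 (c *: p) x y = c * eval2 p x y.
Proof. exact: mevalZ. Qed.
Definition eval2E := (eval2D, eval2N, eval2M, eval2Z, eval2Xn, eval2X,
  eval2Y, eval2C, eval2_1).

Lemma partial_xC c : partial_x c%:MP = 0 :> {mpoly R[2]}.
Proof. exact: mderivC. Qed.
Lemma partial_yC c : partial_y c%:MP = 0 :> {mpoly R[2]}.
Proof. exact: mderivC. Qed.
Lemma partial_xX : partial_x varX = 1 :> {mpoly R[2]}.
Proof.
by rewrite /partial_x mderivX mnm1E eqxx -{1}[U_(_)%MM]add0m addmK mpolyX0 scale1r.
Qed.
Lemma partial_yX : partial_y varX = 0 :> {mpoly R[2]}.
Proof. by rewrite /partial_y mderivX mnm1E scale0r. Qed.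
Lemma partial_xY : partial_x varY = 0 :> {mpoly R[2]}.
Proof. by rewrite /partial_x mderivX mnm1E scale0r. Qed.
Lemma partial_yY : partial_y varY = 1 :> {mpoly R[2]}.
Proof.
by rewrite /partial_y mderivX mnm1E eqxx -{1}[U_(_)%MM]add0m addmK mpolyX0 scale1r.
Qed.
Lemma partial_xD p q : partial_x (p + q) = partial_x p + partial_x q.
Proof. exact: mderivD. Qed.
Lemma partial_yD p q : partial_y (p + q) = partial_y p + partial_y q.
Proof. exact: mderivD. Qed.
Lemma partial_xZ c p : partial_x (c *: p) = c *: partial_x p.
Proof. exact: mderivZ. Qed.
Lemma partial_yZ c p : partial_y (c *: p) = c *: partial_y p.
Proof. exact: mderivZ. Qed.
Lemma partial_xM p q : partial_x (p * q) = partial_x p * q + p * partial_x q.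
Proof. exact: mderivM. Qed.
Lemma partial_yM p q : partial_y (p * q) = partial_y p * q + p * partial_y q.
Proof. exact: mderivM. Qed.
Definition partialE := (partial_xD, partial_yD, partial_xM, partial_yM,
  partial_xZ, partial_yZ, partial_xX, partial_xY, partial_yX, partial_yY).

End Eval.

Lemma is_derive_eval2 (R : realType) (q : {mpoly R[2]}) (f g : R -> R)
    (t df dg : R) :
  is_derive t 1 f df -> is_derive t 1 g dg ->
  is_derive t 1 (fun s => eval2 q (f s) (g s))
    (eval2 (partial_x q) (f t) (g t) * df + eval2 (partial_y q) (f t) (g t) * dg).
Proof.
move=> hf hg; elim/bivar_ind: q => [c|||p q hp hq|p q hp hq].
- rewrite partial_xC partial_yC !eval2C !mul0r addr0.
  under [X in is_derive _ _ X]eq_fun do rewrite eval2C; exact: is_derive_cst.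
- rewrite partial_xX partial_yX eval2_1 eval2C mul0r mul1r addr0.
  by under [X in is_derive _ _ X]eq_fun do rewrite eval2X.
- rewrite partial_xY partial_yY eval2_1 eval2C mul0r mul1r add0r.
  by under [X in is_derive _ _ X]eq_fun do rewrite eval2Y.
- under [X in is_derive _ _ X]eq_fun do rewrite eval2D.
  apply: is_derive_eq (is_deriveD hp hq) _; rewrite !partialE !eval2E; ring.
- under [X in is_derive _ _ X]eq_fun do rewrite eval2M.
  apply: is_derive_eq (is_deriveM hp hq) _; rewrite !partialE !eval2E /GRing.scale /=; ring.
Qed.

Lemma cvg_eval2 (R : realType) (q : {mpoly R[2]}) (T : Type)
    (F : set_system T) (f g : T -> R) (a b : R) :
  Filter F -> f @ F --> a -> g @ F --> b ->
  (fun s => eval2 q (f s) (g s)) @ F --> eval2 q a b.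
Proof.
move=> FF hf hg; elim/bivar_ind: q => [c|||p q hp hq|p q hp hq].
- rewrite eval2C; under eq_fun do rewrite eval2C; exact: cvg_cst.
- by rewrite eval2X; under eq_fun do rewrite eval2X.
- by rewrite eval2Y; under eq_fun do rewrite eval2Y.
- by rewrite eval2D; under eq_fun do rewrite eval2D; exact: cvgD.
- by rewrite eval2M; under eq_fun do rewrite eval2M; exact: cvgM.
Qed.

(** * Growth of the mate on the line y = 0 *)

(** Positivity of the derivative forces its leading coefficient, hence that of
    [s], to be positive. *)
Lemma poly_unbounded_of_deriv_gt0 (R : realFieldType) (s : {poly R}) :
  (forall x, 0 < s^`().[x]) -> forall M, exists2 x, 0 < x & M < s.[x].
Proof.
move=> ds_gt0 M.
have ds_neq0 : s^`() != 0.
  by apply/eqP => ds0; have := ds_gt0 0; rewrite ds0 horner0 ltxx.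
have size_s : (1 < size s)%N.
  by rewrite -subn_gt0 subn1 -polyorder.size_deriv size_poly_gt0.
have lc_s : 0 < lead_coef s.
  have lc_ds : lead_coef s^`() = lead_coef s *+ (size s).-1.
    by rewrite !lead_coefE polyorder.size_deriv coef_deriv prednK // -subn1 subn_gt0.
  case: (ltP 0 (lead_coef s)) => // lc_le0.
  (* Otherwise [- s^`()] is positive far to the right. *)
  have : 0 < lead_coef (- s^`()).
    by rewrite lt_def lead_coef_eq0 oppr_eq0 ds_neq0 lead_coefN lc_ds oppr_ge0 mulrn_wle0.
  case/polyrcf.poly_pinfty_gt_lc => n /(_ n (lexx n)).
  rewrite hornerN lead_coefN lerN2 => /(lt_le_trans (ds_gt0 n)).
  by rewrite lc_ds ltNge mulrn_wle0.
have [n s_ge] := polyrcf.poly_lim_infty (M + 1) lc_s size_s.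
exists (Num.max 1 n); first by rewrite lt_max ltr01.
apply: lt_le_trans (s_ge _ _); first by rewrite ltrDl.
by rewrite le_max lexx orbT.
Qed.

(** Restricting to the line turns questions of growth into questions on a
    univariate polynomial. *)
Lemma eval2_line_poly (R : comNzRingType) (q : {mpoly R[2]}) :
  exists r : {poly R}, forall x,
    r.[x] = eval2 q x 0 /\ r^`().[x] = eval2 (partial_x q) x 0.
Proof.
elim/bivar_ind: q => [c|||p q [r hr] [s hs]|p q [r hr] [s hs]].
- by exists c%:P => x; rewrite derivC !hornerE partial_xC !eval2C.
- by exists 'X => x; rewrite derivX !hornerE partial_xX !eval2E.
- by exists 0 => x; rewrite deriv0 !hornerE partial_xY eval2C !eval2E.
- exists (r + s) => x; rewrite derivD !hornerE partialE !eval2E.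
  by have [-> ->] := hs x; have [-> ->] := hr x.
- exists (r * s) => x; rewrite derivM !hornerE partialE !eval2E.
  by have [-> ->] := hs x; have [-> ->] := hr x.
Qed.

(** On the line the Jacobian determinant is [- q_x], so the polynomial
    [x |-> q(- x, 0)] has positive derivative. *)
Lemma mate_unbounded_on_line (R : realFieldType) (p q : {mpoly R[2]}) :
  (forall x, eval2 (partial_x p) x 0 = 0) ->
  (forall x, eval2 (partial_y p) x 0 = 1) ->
  (forall x, 0 < eval2 (jacobian_det p q) x 0) ->
  forall M, exists2 x, x < 0 & M < eval2 q x 0.
Proof.
move=> px0 py1 J_gt0 M; have [r hr] := eval2_line_poly q.
have [|x x_gt0] := @poly_unbounded_of_deriv_gt0 R (r \Po - 'X) _ M.
  move=> x; rewrite deriv_comp derivN derivX !hornerE horner_comp !hornerE.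
  have := J_gt0 (- x); rewrite /jacobian_det !eval2E px0 py1.
  by have [_ ->] := hr (- x); rewrite mul0r sub0r mul1r mulrN1.
rewrite horner_comp !hornerE; have [-> _] := hr (- x) => ltM.
by exists (- x); rewrite ?oppr_lt0.
Qed.

(** * Monotonicity along level curves *)

(** Here [(u, v)] is a velocity tangent to a level curve of [p].  Eliminating
    [u] between the two differentials gives
    [p_x * dq(u, v) = v * det D(p,q)]; multiplying by [p_x] avoids a division
    and makes the sign of [p_x * v] decide. *)
Lemma directional_deriv_ge0 (R : realFieldType) (px py qx qy u v : R) :
  px * u + py * v = 0 -> 0 < px * qy - py * qx -> 0 < px * v ->
  0 <= qx * u + qy * v.
Proof.
move=> dp0 J_gt0 pxv_gt0.
have px_neq0 : px != 0 by apply: contraTneq pxv_gt0 => ->; rewrite mul0r ltxx.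
have px2_gt0 : 0 < px ^+ 2 by rewrite lt_def sqrf_eq0 px_neq0 sqr_ge0.
rewrite -(pmulr_rge0 _ px2_gt0).
have -> : px ^+ 2 * (qx * u + qy * v) =
    px * qx * (px * u + py * v) + px * v * (px * qy - py * qx) by ring.
by rewrite dp0 mulr0 add0r; apply/ltW/mulr_gt0.
Qed.

(** The condition on [p_x * dg] fixes the direction of travel: it says that the
    curve is run through along the Hamiltonian field [(- p_y, p_x)]. *)
Lemma mate_le_along_level (R : realType) (p q : {mpoly R[2]}) (f g dg : R -> R)
    (a b c : R) :
  (forall x y, 0 < eval2 (jacobian_det p q) x y) -> a <= b ->
  {in `[a, b], forall s : R, derivable f s 1} ->
  {in `[a, b], forall s : R, is_derive s 1 g (dg s)} ->
  {in `[a, b], forall s : R, eval2 p (f s) (g s) = c} ->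
  {in `[a, b], forall s : R, 0 < eval2 (partial_x p) (f s) (g s) * dg s} ->
  eval2 q (f a) (g a) <= eval2 q (f b) (g b).
Proof.
move=> J_gt0 le_ab df hg level px_gt0.
pose h s := eval2 q (f s) (g s).
pose dh s := eval2 (partial_x q) (f s) (g s) * 'D_1 f s
             + eval2 (partial_y q) (f s) (g s) * dg s.
have hh : {in `[a, b], forall s : R, is_derive s 1 h (dh s)}.
  move=> s s_ab; apply: is_derive_eval2; last exact: hg.
  exact/derivableP/df.
have cont_h : {within [set` `[a, b]], continuous h}.
  by apply: derivable_within_continuous => s /hh [].
have h_oo s : s \in `]a, b[ -> is_derive s 1 h (dh s).
  by move=> s_ab; apply: hh; apply: subset_itv_oo_cc.
suff dh_ge0 s : s \in `]a, b[ -> 0 <= dh s.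
  rewrite -/(h a) -/(h b).
  move: le_ab; rewrite le_eqVlt => /predU1P[-> //|lt_ab].
  have [s s_ab e] := MVT lt_ab h_oo cont_h.
  by rewrite -subr_ge0 e mulr_ge0 ?dh_ge0 // subr_ge0 ltW.
move=> s_oo; have s_ab : s \in `[a, b] by exact: subset_itv_oo_cc.
(* The velocity is tangent to the level curve: differentiate the constant. *)
have dp0 : eval2 (partial_x p) (f s) (g s) * 'D_1 f s
           + eval2 (partial_y p) (f s) (g s) * dg s = 0.
  have [_ <-] : is_derive s 1 (fun t => eval2 p (f t) (g t))
    (eval2 (partial_x p) (f s) (g s) * 'D_1 f s
           + eval2 (partial_y p) (f s) (g s) * dg s).
    by apply: is_derive_eval2; [exact/derivableP/df | exact: hg].
  have [] // : is_derive s 1 (fun t => eval2 p (f t) (g t)) 0.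
  apply: near_eq_is_derive (is_derive_cst c s 1).
  near=> t; apply/esym/level/subset_itv_oo_cc.
  by near: t; exact: near_in_itvoo.
move: (J_gt0 (f s) (g s)) (px_gt0 s s_ab).
by rewrite /dh /jacobian_det !eval2E; exact: directional_deriv_ge0 dp0.
Unshelve. all: by end_near. Qed.

(** * The folding criterion *)

(** The curve [s |-> (xi x t s, sg * s)], for [t <= s <= 1], starts at
    [(x, sg * t)], next to the line, and stays on one level of [p].  Its end
    point tends, as [t] tends to [0], to a point [(a, sg)] that is independent
    of [x]: this is where folding enters, and it gives one upper bound
    [q(a, sg)] for all the values [q(x, 0)] with [x < 0].  The sign [sg] selects
    the side of the line on which the levels fold. *)
Lemma no_mate_of_folded_levels (R : realType) (p : {mpoly R[2]}) (sg a : R)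
    (xi : R -> R -> R -> R) :
  (forall x, eval2 (partial_x p) x 0 = 0) ->
  (forall x, eval2 (partial_y p) x 0 = 1) ->
  (forall x t, x < 0 -> 0 < t < 1 ->
    [/\ xi x t t = x,
        {in `[t, 1], forall s : R, derivable (xi x t) s 1},
        {in `[t, 1], forall s : R,
           eval2 p (xi x t s) (sg * s) = eval2 p x (sg * t)}
      & {in `[t, 1], forall s : R,
           0 < eval2 (partial_x p) (xi x t s) (sg * s) * sg}]) ->
  (forall x, x < 0 -> xi x t 1 @[t --> 0^'+] --> a) ->
  ~ exists q : {mpoly R[2]}, forall x y, 0 < eval2 (jacobian_det p q) x y.
Proof.
move=> px0 py1 hxi xi_lim [q J_gt0].
(* The line carries a value above [q a sg]; folding says it cannot. *)
have [x x_lt0] := mate_unbounded_on_line px0 py1 (J_gt0^~ 0) (eval2 q a sg).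
apply/negP; rewrite -leNgt.
have id_cvg : t @[t --> (0 : R)^'+] --> (0 : R).
  exact/cvg_at_right_filter/cvg_id.
have start_cvg : eval2 q x (sg * t) @[t --> (0 : R)^'+] --> eval2 q x 0.
  apply: cvg_eval2; first exact: cvg_cst.
  by rewrite -[X in _ --> X](mulr0 sg); apply: cvgM => //; exact: cvg_cst.
have end_cvg : eval2 q (xi x t 1) sg @[t --> (0 : R)^'+] --> eval2 q a sg.
  by apply: cvg_eval2; [exact: xi_lim | exact: cvg_cst].
apply: (ler_cvg_to start_cvg end_cvg).
near=> t.
have t_in : 0 < t < 1.
  by apply/andP; split; near: t; [exact: nbhs_right_gt | exact: nbhs_right_lt].
have [xi_start d_xi level px_gt0] := hxi x t x_lt0 t_in.
have := @mate_le_along_level R p q (xi x t) ( *%R sg) (fun=> sg) t 1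
  (eval2 p x (sg * t)) J_gt0.
rewrite xi_start mulr1; apply => //; first by case/andP: t_in => _ /ltW.
move=> s _; apply: (is_derive_eq (is_deriveZ sg (is_derive_id s 1))).
exact: mulr1.
Unshelve. all: by end_near. Qed.

(** * The two shapes of polynomials *)

Lemma cvg_right_horner (R : realType) (h : {poly R}) (f : R -> R) :
  (forall t, f t = h.[t]) -> f t @[t --> 0^'+] --> h.[0].
Proof.
move=> fE; have -> : f = horner h by exact/funext.
exact/cvg_at_right_filter/continuous_horner.
Qed.

(** The folding happens above the line: [p_x = y^(k+1)] is positive there, and
    the levels through [(x, t)] reach height [1] near [(g(0) - g(1), 1)]. *)
Lemma no_mate_linear_in_x (R : realType) (p : {mpoly R[2]}) (g : {poly R})
    (k : nat) :
  (forall x y, eval2 p x y = g.[y] + x * y ^+ k.+1) ->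
  (forall x y, eval2 (partial_x p) x y = y ^+ k.+1) ->
  (forall x, eval2 (partial_y p) x 0 = 1) ->
  ~ exists q : {mpoly R[2]}, forall x y, 0 < eval2 (jacobian_det p q) x y.
Proof.
move=> pE pxE py1.
(* Solve [p = p(x, t)] for the abscissa at height [s]. *)
pose xi x t s : R := (g.[t] + x * t ^+ k.+1 - g.[s]) / s ^+ k.+1.
apply: (@no_mate_of_folded_levels _ _ 1 (g.[0] - g.[1]) xi) => // [x|x t x_lt0|x x_lt0].
- by rewrite pxE expr0n.
- case/andP => t_gt0 t_lt1.
  have s_gt0 s : s \in `[t, 1] -> 0 < s ^+ k.+1.
    by rewrite in_itv /= => /andP[/(lt_le_trans t_gt0) s_gt0 _]; exact: exprn_gt0.
  split=> [|s /s_gt0 s0|s /s_gt0 s0|s /s_gt0 s0].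
  + by rewrite /xi addrAC subrr add0r mulfK // gt_eqF // exprn_gt0.
  + apply: derivableM; last first.
      by apply: derivableV; [rewrite gt_eqF | exact: exprn_derivable].
    by apply: derivableB; [exact: derivable_cst | exact: derivable_horner].
  + by rewrite !pE !mul1r divfK ?gt_eqF // addrC subrK.
  + by rewrite pxE mul1r mulr1.
- rewrite /xi expr1n; under eq_fun do rewrite divr1.
  apply: cvgB; last exact: cvg_cst.
  have -> : g.[0] = (g + x *: 'X^(k.+1)).[0] by rewrite !hornerE expr0n mulr0 addr0.
  by apply: cvg_right_horner => t; rewrite !hornerE.
Qed.

(** The folding happens below the line, where the levels near [0] satisfy
    [x y = sqrt (c - g(y))] on their half [x < 0]; monotonicity of [g] keeps the
    radicand positive all the way from [y = - t] to [y = - 1].  There both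
    [p_x] and the variation of [y] are negative. *)
Lemma no_mate_quadratic_in_x (R : realType) (p : {mpoly R[2]}) (g : {poly R}) :
  (forall x y, eval2 p x y = g.[y] + x ^+ 2 * y ^+ 2) ->
  (forall x y, eval2 (partial_x p) x y = 2 * x * y ^+ 2) ->
  (forall x, eval2 (partial_y p) x 0 = 1) ->
  {homo horner g : y z / y <= z} ->
  ~ exists q : {mpoly R[2]}, forall x y, 0 < eval2 (jacobian_det p q) x y.
Proof.
move=> pE pxE py1 g_mono.
(* [rad] is [p(x, - t) - g(- s)], the square of the product of the
   coordinates of the point at height [- s]. *)
pose rad x t s : R := g.[- t] - g.[- s] + x ^+ 2 * t ^+ 2.
pose xi x t s : R := - (Num.sqrt (rad x t s) / s).
pose a : R := - Num.sqrt (g.[0] - g.[- 1]).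
apply: (@no_mate_of_folded_levels _ _ (- 1) a xi) => // [x|x t x_lt0|x x_lt0].
- by rewrite pxE expr0n mulr0.
- case/andP => t_gt0 t_lt1.
  have s_gt0 s : s \in `[t, 1] -> 0 < s.
    by rewrite in_itv /= => /andP[/(lt_le_trans t_gt0)].
  have rad_gt0 s : s \in `[t, 1] -> 0 < rad x t s.
    rewrite in_itv /= => /andP[le_ts _]; apply: ltr_wpDl.
      by rewrite subr_ge0 g_mono // lerN2.
    by apply: mulr_gt0; [rewrite -sqrrN exprn_gt0 // oppr_gt0 | exact: exprn_gt0].
  split=> [|s s_in|s s_in|s s_in].
  + rewrite /xi /rad subrr add0r -exprMn sqrtr_sqr normrM ltr0_norm // gtr0_norm //.
    by rewrite mulfK ?opprK // gt_eqF.
  + apply: derivableN; apply: derivableM; last first.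
      by apply: derivableV; [rewrite gt_eqF ?s_gt0 | exact: derivable_id].
    have drad : derivable (rad x t) s 1.
      apply: derivableD; last exact: derivable_cst.
      apply: derivableB; first exact: derivable_cst.
      have -> : (fun s => g.[- s]) = horner (g \Po (- 'X)).
        by apply/funext => r; rewrite horner_comp !hornerE.
      exact: derivable_horner.
    by have [] := @is_derive1_comp R Num.sqrt (rad x t) s _ _
      (is_derive1_sqrt (rad_gt0 s s_in)) (derivableP drad).
  + rewrite !pE !mulN1r /xi !sqrrN expr_div_n sqr_sqrtr ?ltW ?rad_gt0 //.
    rewrite divfK ?expf_neq0 ?gt_eqF ?s_gt0 // /rad; ring.
  + rewrite pxE mulrN1 mulrN oppr_gt0.
    rewrite mulN1r sqrrN pmulr_llt0 ?exprn_gt0 ?s_gt0 //.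
    rewrite oppr_lt0; apply: mulr_gt0; first exact: ltr0n.
    by apply: divr_gt0; [rewrite sqrtr_gt0 rad_gt0 | exact: s_gt0].
- rewrite /xi; under eq_fun do rewrite divr1.
  apply: cvgN; apply: continuous_cvg; first exact: sqrt_continuous.
  have -> : g.[0] - g.[- 1] = (g \Po (- 'X) - g.[- 1]%:P + (x ^+ 2) *: 'X^2).[0].
    by rewrite !hornerE horner_comp !hornerE oppr0 /= !mulr0 addr0.
  by apply: cvg_right_horner => t; rewrite /rad !hornerE horner_comp !hornerE.
Qed.

(** The difference quotient is a quadratic polynomial in [y] and [z], whose
    decomposition into squares leaves the constant [(3 - a^2) / 3]. *)
Lemma cubic_nondecreasing (R : realFieldType) (a : R) : a ^+ 2 - 3 < 0 ->
  {homo horner ('X + a *: 'X^2 + 'X^3) : y z / y <= z}.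
Proof.
move=> a2_lt3 y z le_yz; rewrite -subr_ge0.
have -> : ('X + a *: 'X^2 + 'X^3).[z] - ('X + a *: 'X^2 + 'X^3).[y] =
    (z - y) * (1 + a * (y + z) + (y ^+ 2 + y * z + z ^+ 2)).
  by rewrite !(hornerD, hornerZ, hornerXn, hornerX); ring.
rewrite mulr_ge0 ?subr_ge0 //.
have -> : 1 + a * (y + z) + (y ^+ 2 + y * z + z ^+ 2) =
  3 / 4 * (y + z + 2 / 3 * a) ^+ 2 + (3 - a ^+ 2) / 3 + (y - z) ^+ 2 / 4 by field.
have := sqr_ge0 (y + z + 2 / 3 * a); have := sqr_ge0 (y - z); lra.
Qed.

Theorem theorem5p5 (R : realType) (p : {mpoly R[2]})
  (hp : [\/ p = varY + varX * varY ^+ 2 + varY ^+ 4,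
            (exists a02 : R, (a02 = 0 \/ a02 = 1) /\
               p = varY + a02 *: varY ^+ 2 + varX * varY ^+ 3),
            p = varY + varX ^+ 2 * varY ^+ 2
          | (exists a02 : R, a02 ^+ 2 - 3 < 0 /\
               p = varY + a02 *: varY ^+ 2 + varY ^+ 3
                   + varX ^+ 2 * varY ^+ 2)]) :
  ~ (exists q : {mpoly R[2]},
       forall x y : R, 0 < eval2 (jacobian_det p q) x y).
Proof.
case: hp => [->|[a [_ ->]]|->|[a [a2_lt3 ->]]].
- apply: (@no_mate_linear_in_x _ _ ('X + 'X^4) 1) => [x y|x y|x];
    rewrite ?(exprS varX, exprS varY) ?expr0 ?mulr1 ?partialE ?eval2E
      ?(hornerD, hornerZ, hornerXn, hornerX); ring.
- apply: (@no_mate_linear_in_x _ _ ('X + a *: 'X^2) 2) => [x y|x y|x];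
    rewrite ?(exprS varX, exprS varY) ?expr0 ?mulr1 ?partialE ?eval2E
      ?(hornerD, hornerZ, hornerXn, hornerX); ring.
- apply: (@no_mate_quadratic_in_x _ _ 'X) => [x y|x y|x|y z];
    rewrite ?(exprS varX, exprS varY) ?expr0 ?mulr1 ?partialE ?eval2E
      ?(hornerD, hornerZ, hornerXn, hornerX) //; ring.
- apply: (@no_mate_quadratic_in_x _ _ ('X + a *: 'X^2 + 'X^3)) => [x y|x y|x|];
    last exact: cubic_nondecreasing;
    rewrite ?(exprS varX, exprS varY) ?expr0 ?mulr1 ?partialE ?eval2E
      ?(hornerD, hornerZ, hornerXn, hornerX); ring.
Qed.
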